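(* Let $p>0$, let $A(t)$ be a real $n\times n$ matrix and $g(t)\in\mathbb{R}^n$ a vector, both with continuous $p$-periodic entries, and let $f=(f_1,\dots,f_n):\mathbb{R}^n\to\mathbb{R}^n$ be continuous. Consider the system $$x'+A(t)x+f(x)=g(t). \qquad ( * )$$ Assume that the linear part is at resonance, i.e. both $x'+A(t)x=0$ and the adjoint system $z'-A^T(t)z=0$ have non-trivial $p$-periodic solutions, and that the adjoint system $z'-A^T(t)z=0$ has a positive $p$-periodic solution $z(t)$ (that is, $z_i(t)>0$ for all $t$ and all $i$). Assume that there are constants $\alpha_i,\beta_i$, $i=1,\dots,n$, such that $$\alpha_i<f_i(x)<\beta_i\quad\text{for all } x\in\mathbb{R}^n \text{ and all } i.$$ Then $( * )$ may have a $p$-periodic solution only if $$\sum_{i=1}^n\alpha_i\int_0^p z_i(t)\,dt<\int_0^p g(t)\cdot z(t)\,dt<\sum_{i=1}^n\beta_i\int_0^p z_i(t)\,dt. \qquad ( ** )$$ In case condition $( ** )$ fails, all solutions of $( * )$ are unbounded as $t\to\infty$ and as $t\to-\infty$.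
   Context: $A^T$ denotes the transpose and $\cdot$ the scalar product in $\mathbb{R}^n$. A solution $x(t)$ is unbounded as $t\to\infty$ (respectively $t\to-\infty$) if $\|x(t)\|$ is unbounded on $[0,\infty)$ (respectively on $(-\infty,0]$). *)

(* Defs.v *)
From HB Require Import structures.
From mathcomp Require Import all_boot all_order all_algebra.
From mathcomp Require Import all_classical all_reals all_analysis.

Set Implicit Arguments.
Unset Strict Implicit.
Unset Printing Implicit Defensive.

Import Order.TTheory GRing.Theory Num.Theory.
Import numFieldNormedType.Exports.

Local Open Scope classical_set_scope.
Local Open Scope ring_scope.

Definition dotv (R : realType) (n : nat) (u v : 'cV[R]_n) : R :=
  \sum_(i < n) u i 0 * v i 0.

(* Solutions are defined on the whole real line; continuity of the derivative
   is a consequence of the equation when A, f and g are continuous. *)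
Definition solves (R : realType) (n : nat) (A : R -> 'M[R]_n)
    (f : 'cV[R]_n -> 'cV[R]_n) (g : R -> 'cV[R]_n) (x : R -> 'cV[R]_n) : Prop :=
  forall t : R, derivable x t 1 /\ x^`()%classic t + A t *m x t + f (x t) = g t.

Definition solves_linear (R : realType) (n : nat) (A : R -> 'M[R]_n)
    (x : R -> 'cV[R]_n) : Prop :=
  forall t : R, derivable x t 1 /\ x^`()%classic t + A t *m x t = 0.

Definition solves_adjoint (R : realType) (n : nat) (A : R -> 'M[R]_n)
    (z : R -> 'cV[R]_n) : Prop :=
  forall t : R, derivable z t 1 /\ z^`()%classic t - (A t)^T *m z t = 0.

Definition at_resonance (R : realType) (n : nat) (p : R)
    (A : R -> 'M[R]_n) : Prop :=
  (exists x : R -> 'cV[R]_n,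
     [/\ solves_linear A x, periodic x p & exists t, x t != 0]) /\
  (exists z : R -> 'cV[R]_n,
     [/\ solves_adjoint A z, periodic z p & exists t, z t != 0]).

(* The norm on columns is the library's sup norm; boundedness does not depend
   on the choice of norm on R^n. *)
Definition unbounded_pinfty (R : realType) (n : nat)
    (x : R -> 'cV[R]_n) : Prop :=
  ~ [bounded x t | t in `[0, +oo[].

Definition unbounded_ninfty (R : realType) (n : nat)
    (x : R -> 'cV[R]_n) : Prop :=
  ~ [bounded x t | t in `]-oo, 0]].

Definition solvability_condition (R : realType) (n : nat) (p : R)
    (alpha beta : 'I_n -> R) (g z : R -> 'cV[R]_n) : Prop :=
  \sum_(i < n) alpha i * \int[lebesgue_measure]_(t in `[0, p]) z t i 0
    < \int[lebesgue_measure]_(t in `[0, p]) dotv (g t) (z t)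
    < \sum_(i < n) beta i * \int[lebesgue_measure]_(t in `[0, p]) z t i 0.

(* Main.v *)
Require Import Defs.
From HB Require Import structures.
From mathcomp Require Import all_boot all_order all_algebra.
From mathcomp Require Import all_classical all_reals all_analysis.
From mathcomp Require Import ring lra.

Set Implicit Arguments.
Unset Strict Implicit.
Unset Printing Implicit Defensive.

Import Order.TTheory GRing.Theory Num.Theory.
Import numFieldNormedType.Exports.

Local Open Scope classical_set_scope.
Local Open Scope ring_scope.

(** The scalar function V(t) = x(t).z(t) is what makes the theorem work.  If
    x solves the nonlinear system and z the adjoint one, the terms in A cancel
    and V' = (g - f(x)).z, whatever A is.  Over one period this gives, for any
    constants gamma_i,
      V(p) - V(0) = gap(gamma) + p * sum_i (gamma_i - f_i(x(c))) z_i(c)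
    at some intermediate time c, where gap(gamma) denotes
    int_0^p g.z - sum_i gamma_i int_0^p z_i ([pairing_increment]).  Applying
    the mean value theorem to V minus a primitive of g.z - sum_i gamma_i z_i
    keeps f o x out of the integrals and yields strict inequalities at once.

    For gamma = beta the last sum is positive, for gamma = alpha it is
    negative.  A periodic solution has V(p) = V(0), so
    gap(beta) < 0 < gap(alpha), which is the solvability condition ([gap_lt_increment]).

    If the condition fails, say gap(beta) >= 0, then V increases over every
    period.  As long as x stays in a ball of radius M the increase is at least
    some d(M) > 0, by compactness of the ball and of [0, p]
    ([uniform_increment]), whereas |V(kp)| = |x(kp).z(0)| is at most a multiple
    of M.  Hence a solution cannot stay in the ball during N(M) consecutive
    periods, with N(M) independent of the solution ([uniform_escape]).  Since
    translates of solutions by multiples of p are solutions, this one estimate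
    excludes boundedness both on [0, +oo[ and on ]-oo, 0].

    The cases of beta and alpha are treated together through a factor s,
    which is 1 for beta and -1 for alpha. *)

Section Preliminaries.
Context {R : realType}.

(** * Primitives, compactness and derivatives *)

(** Starting the integral at a - 1 makes a and b interior points, so that the
    primitive is differentiable on the closed segment without one-sided
    derivatives. *)
Lemma exists_primitive (a b : R) (h : R -> R) : a < b -> continuous h ->
  exists F : R -> R, (forall t, t \in `[a, b] -> is_derive t 1 F (h t)) /\
    F b - F a = \int[lebesgue_measure]_(t in `[a, b]) h t.
Proof.
move=> ab hcont.
have hint c d : lebesgue_measure.-integrable `[c, d] (EFin \o h).
  apply: continuous_compact_integrable; first exact: segment_compact.
  exact: continuous_subspaceT.
pose F x := \int[lebesgue_measure]_(t in `[a - 1, x]) h t.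
have F'h t : t \in `[a, b] -> derivable F t 1 /\ F^`()%classic t = h t.
  rewrite in_itv/= => /andP[a_le_t t_le_b].
  apply: (@continuous_FTC1_closed _ h (a - 1) t (b + 1)) => //.
  - by rewrite (le_lt_trans t_le_b)// ltrDl.
  - by rewrite (lt_le_trans _ a_le_t)// gtrBl.
  - exact: hcont.
exists F; split.
  move=> t /F'h[dF Ft]; apply: DeriveDef; first exact: dF.
  by rewrite -derive1E; exact: Ft.
have Fab : {in `]a, b[, F^`()%classic =1 h}.
  move=> t tab; apply: (F'h t _).2.
  exact: subset_itv_oo_cc tab.
rewrite /Rintegral (@continuous_FTC2 _ h F a b ab)//.
- exact: continuous_subspaceT.
- have Fcont t : t \in `[a, b] -> {for t, continuous F}.
    by move=> /F'h[dF _]; apply/differentiable_continuous/derivable1_diffP.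
  split.
  + by move=> t tab; apply: (F'h t _).1; exact: subset_itv_oo_cc tab.
  + by apply/cvg_at_right_filter/Fcont; rewrite in_itv/= lexx ltW.
  + by apply/cvg_at_left_filter/Fcont; rewrite in_itv/= lexx ltW.
Qed.

Lemma le_entry_norm m n (M : 'M[R]_(m, n)) i j : `|M i j| <= `|M|.
Proof.
rewrite [leRHS]/Num.norm /= mx_normrE; apply/bigmax_geP; right => /=.
by exists (i, j).
Qed.

Lemma continuous_trmx m n : continuous (@trmx R m n).
Proof.
move=> /= M s /= /(nbhs_ballP (M^T)) [e e0 es].
apply/nbhs_ballP; exists e => //= N [_ MN]; apply: es; split => // i j.
by rewrite !mxE.
Qed.

(** The ball lies in a product of segments, which is compact; that product is
    taken among row vectors, whence the transposes. *)
Lemma pos_lower_bound_on_ball n (phi : 'cV[R]_n -> R) (M : R) :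
  continuous phi -> (forall y, 0 < phi y) ->
  exists2 e, 0 < e & forall y, `|y| <= M -> e <= phi y.
Proof.
move=> phi_cont phi_gt0.
have [M_lt0|M_ge0] := ltP M 0.
  exists 1 => // y yM.
  by have := le_lt_trans (le_trans (normr_ge0 y) yM) M_lt0; rewrite ltxx.
pose K := [set v : 'rV[R]_n | forall i, `[- M, M]%classic (v ord0 i)].
have Kcompact : compact K.
  by apply: (@rV_compact _ _ (fun=> `[- M, M]%classic)) => i; exact: segment_compact.
have K0 : K !=set0.
  exists 0 => i; rewrite /= mxE in_itv/= M_ge0 andbT oppr_le0//.
have [c _ cmin] : exists2 c, c \in K &
    forall v, v \in K -> (phi \o trmx) c <= (phi \o trmx) v.
  apply: (@compact_EVT_min _ _ (phi \o trmx) K) => //.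
  apply: continuous_subspaceT => v.
  apply: (@continuous_comp _ _ _ trmx phi).
    exact: continuous_trmx.
  exact: phi_cont.
exists (phi c^T) => // y yM.
have := cmin y^T; rewrite /= trmxK; apply.
rewrite inE => i /=; rewrite in_itv/= mxE -ler_norml.
exact: le_trans (le_entry_norm _ _ _) yM.
Qed.

Lemma dotv_mulmxl n (A : 'M[R]_n) (u v : 'cV[R]_n) :
  dotv (A *m u) v = dotv u (A^T *m v).
Proof.
have dotvE (a b : 'cV[R]_n) : dotv a b = (a^T *m b) 0 0.
  by rewrite mxE; apply: eq_bigr => i _; rewrite mxE.
by rewrite !dotvE trmx_mul mulmxA.
Qed.

Lemma is_derive_entry m n (x : R -> 'M[R]_(m, n)) (t : R) i j :
  derivable x t 1 -> is_derive t 1 (fun s => x s i j) (x^`()%classic t i j).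
Proof.
move=> dx; apply: DeriveDef; first by move/derivable_mxP: dx; exact.
by rewrite derive1E derive_mx// mxE.
Qed.

Lemma derivable_shift (V : normedModType R) (x : R -> V) (k t : R) :
  derivable x (t + k) 1 ->
  derivable (fun s => x (s + k)) t 1 /\
  (fun s => x (s + k))^`()%classic t = x^`()%classic (t + k).
Proof.
rewrite !derive1E /derivable /derive /=.
have -> : (fun h : R => h^-1 *: (((fun s => x (s + k)) \o shift t) (h *: 1) -
     x (t + k))) = (fun h : R => h^-1 *: ((x \o shift (t + k)) (h *: 1) - x (t + k))).
  by apply/funext => h /=; rewrite addrA.
by [].
Qed.


Lemma continuous_dotv n (u v : R -> 'cV[R]_n) :
  (forall i, continuous (fun t => u t i 0)) ->
  (forall i, continuous (fun t => v t i 0)) ->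
  continuous (fun t => dotv (u t) (v t)).
Proof.
move=> u_cont v_cont t; apply: cvg_big => [|i _]; first exact: add_continuous.
apply: continuousM; [exact: u_cont|exact: v_cont].
Qed.

Lemma is_derive_dotv n (x z : R -> 'cV[R]_n) (t : R) :
  derivable x t 1 -> derivable z t 1 ->
  is_derive t 1 (fun s => dotv (x s) (z s))
    (dotv (x^`()%classic t) (z t) + dotv (x t) (z^`()%classic t)).
Proof.
move=> dx dz.
have -> : (fun s => dotv (x s) (z s)) =
    \sum_(i < n) ((fun s => x s i 0) * (fun s => z s i 0)).
  by apply/funext => s; rewrite fct_sumE.
rewrite /dotv -big_split/=; apply: is_derive_sum => i.
apply: is_derive_eq.
  by apply: is_deriveM; apply: is_derive_entry.
by rewrite addrC; congr (_ + _); exact: mulrC.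
Qed.

(** * The pairing of a solution with an adjoint solution *)

Lemma solves_shift n (A : R -> 'M[R]_n) f g x k :
  periodic A k -> periodic g k -> solves A f g x ->
  solves A f g (fun t => x (t + k)).
Proof.
move=> A_per g_per x_sol t; have [dx xE] := x_sol (t + k).
have [dxk ->] := derivable_shift dx; split=> //.
by rewrite -(A_per t) -(g_per t).
Qed.

End Preliminaries.

Section Balance.
Context {R : realType} (n : nat) (p : R) (A : R -> 'M[R]_n)
  (f : 'cV[R]_n -> 'cV[R]_n) (g z : R -> 'cV[R]_n).
Context (p_gt0 : 0 < p) (g_cont : forall i, continuous (fun t => g t i 0))
  (z_sol : solves_adjoint A z).

Let z_cont i : continuous (fun t => z t i 0).
Proof.
move=> t; apply/differentiable_continuous/derivable1_diffP.
by have [/derivable_mxP + _] := z_sol t; exact.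
Qed.

(** The solvability condition says that this quantity is positive for alpha
    and negative for beta. *)
Definition solvability_gap (gamma : 'I_n -> R) : R :=
  \int[lebesgue_measure]_(t in `[0, p]) dotv (g t) (z t) -
  \sum_(i < n) gamma i * \int[lebesgue_measure]_(t in `[0, p]) z t i 0.

(** The terms in A cancel because z solves the adjoint system. *)
Lemma is_derive_pairing x (t : R) : solves A f g x ->
  is_derive t 1 (fun s => dotv (x s) (z s)) (dotv (g t - f (x t)) (z t)).
Proof.
move=> x_sol; have [dx xE] := x_sol t; have [dz zE] := z_sol t.
apply: is_derive_eq; first exact: is_derive_dotv.
have -> : x^`()%classic t = g t - f (x t) - A t *m x t.
  by rewrite -xE addrK addrK.
have -> : z^`()%classic t = (A t)^T *m z t by apply/eqP; rewrite -subr_eq0 zE.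
rewrite -dotv_mulmxl /dotv -big_split/=; apply: eq_bigr => i _.
by rewrite -mulrDl !mxE subrK.
Qed.

(** Mean value theorem for the pairing minus a primitive of
    g.z - sum_i gamma_i z_i, whose derivative is the last sum. *)
Lemma pairing_increment (gamma : 'I_n -> R) x : solves A f g x ->
  exists2 c, c \in `]0, p[ & dotv (x p) (z p) - dotv (x 0) (z 0) =
    solvability_gap gamma + p * \sum_(i < n) (gamma i - f (x c) i 0) * z c i 0.
Proof.
move=> x_sol.
have [G [G' G_int]] := exists_primitive p_gt0 (continuous_dotv g_cont z_cont).
have /choice[Z ZP] (i : 'I_n) := exists_primitive p_gt0 (@z_cont i).
pose V s := dotv (x s) (z s).
pose Phi := V - G + \sum_(i < n) gamma i \*: Z i.
have Phi' t : t \in `[0, p] ->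
    is_derive t 1 Phi (\sum_(i < n) (gamma i - f (x t) i 0) * z t i 0).
  move=> tp; apply: is_derive_eq.
    apply: is_deriveD.
      apply: is_deriveB; [exact: is_derive_pairing | exact: G'].
    by apply: is_derive_sum => i; apply: is_deriveZ; apply: (ZP i).1.
  rewrite /dotv -sumrB -big_split/=; apply: eq_bigr => i _.
  by rewrite /GRing.scale/= !mxE; ring.
have [c cp PhiE] := @MVT R Phi
  (fun t => \sum_(i < n) (gamma i - f (x t) i 0) * z t i 0) 0 p p_gt0
  (fun t tp => Phi' t (subset_itv_oo_cc tp))
  (derivable_within_continuous (fun t tp => @ex_derive _ _ _ _ _ _ _ (Phi' t tp))).
exists c => //; move: PhiE; rewrite subr0 mulrC => <-.
rewrite /solvability_gap -G_int.
under eq_bigr do rewrite -(ZP _).2.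
rewrite /Phi !fctE !fct_sumE /V.
have -> : \sum_(i < n) gamma i * (Z i p - Z i 0) =
    \sum_(i < n) (gamma i \*: Z i) p - \sum_(i < n) (gamma i \*: Z i) 0.
  by rewrite -sumrB; apply: eq_bigr => i _; rewrite mulrBr.
ring.
Qed.

(** * Growth over one period and escape from balls *)

Context (s : R) (gamma : 'I_n -> R) (i0 : 'I_n).
Context (f_cont : continuous f)
  (A_per : periodic A p) (g_per : periodic g p) (z_per : periodic z p)
  (z_gt0 : forall t i, 0 < z t i 0)
  (gamma_side : forall y i, 0 < s * (gamma i - f y i 0)).

(** One index is enough to bound the drift from below, all the terms having
    the same sign; the index i0 records that the dimension is positive. *)
Lemma signed_drift_ge y t :
  s * (gamma i0 - f y i0 0) * z t i0 0 <=
  s * \sum_(i < n) (gamma i - f y i 0) * z t i 0.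
Proof.
rewrite mulr_sumr (bigD1 i0)//= mulrA lerDl; apply: sumr_ge0 => i _.
by rewrite mulrA ltW// mulr_gt0.
Qed.

Lemma gap_lt_increment x : solves A f g x ->
  s * solvability_gap gamma < s * (dotv (x p) (z p) - dotv (x 0) (z 0)).
Proof.
move=> /(pairing_increment gamma)[c _ ->].
rewrite [ltRHS]mulrDr ltrDl mulrCA mulr_gt0//.
by apply: lt_le_trans (signed_drift_ge _ _); rewrite mulr_gt0.
Qed.

(** The strict bounds on f need not be uniform on the whole space, but they are
    on a ball, where the continuous function s (gamma_i0 - f_i0) is bounded
    below by a constant e > 0; the weight z_i0 is likewise at least its
    positive minimum over one period. *)
Lemma uniform_increment M : exists2 d, 0 < d & forall x, solves A f g x ->
  (forall t, 0 <= t <= p -> `|x t| <= M) ->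
  s * solvability_gap gamma + d <= s * (dotv (x p) (z p) - dotv (x 0) (z 0)).
Proof.
have [e e_gt0 e_le] : exists2 e, 0 < e &
    forall y, `|y| <= M -> e <= s * (gamma i0 - f y i0 0).
  apply: pos_lower_bound_on_ball => // y.
  apply: (@continuous_comp _ _ _ (fun v => f v i0 0)
    (fun r : R => s * (gamma i0 - r))).
    apply: (@continuous_comp _ _ _ f (fun v => v i0 0)); first exact: f_cont.
    exact: coord_continuous.
  apply: cvgM; first exact: cvg_cst.
  by apply: cvgB; [exact: cvg_cst|exact: cvg_id].
have [c _ c_min] := EVT_min (ltW p_gt0) (continuous_subspaceT (@z_cont i0)).
exists (p * (e * z c i0 0)); first by rewrite !mulr_gt0.
move=> x x_sol xM; have [t tp ->] := pairing_increment gamma x_sol.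
rewrite [leRHS]mulrDr lerD2l [leRHS]mulrCA ler_pM2l//.
apply: le_trans (signed_drift_ge _ _).
have t0p : t \in `[0, p] by exact: subset_itv_oo_cc tp.
apply: ler_pM; [exact: ltW|exact: ltW| |exact: c_min].
by apply/e_le/xM; rewrite !(itvP t0p).
Qed.

(** The pairing at the times k p grows at least linearly in k while the
    solution stays in the ball, but is bounded there because z(k p) = z(0).
    As N depends only on M, the estimate can be used on any window of N
    periods, in the past as well as in the future. *)
Lemma uniform_escape M : 0 <= s * solvability_gap gamma ->
  exists N : nat, forall x, solves A f g x ->
    ~ (forall t, 0 <= t <= p *+ N -> `|x t| <= M).
Proof.
move=> gap_ge0; have [d d_gt0 d_incr] := uniform_increment M.
pose B := `|s| * \sum_(i < n) M * z 0 i 0.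
have pairing_le y : `|y| <= M -> `|s * dotv y (z 0)| <= B.
  move=> yM; rewrite normrM ler_wpM2l// (le_trans (ler_norm_sum _ _ _))//.
  apply: ler_sum => i _; rewrite normrM (gtr0_norm (z_gt0 _ _)).
  by rewrite ler_wpM2r// ?(le_trans (le_entry_norm _ _ _) yM)// ltW.
(* Inside the ball s V stays between -B and B, and it gains at least d per
   period. *)
pose N := Num.Def.archi_bound `|(B + B) / d|.
exists N => x x_sol xM.
have zp : z p = z 0 by rewrite -[in LHS](add0r p) z_per.
have grow k : (k <= N)%N ->
    s * dotv (x 0) (z 0) + d *+ k <= s * dotv (x (p *+ k)) (z 0).
  elim: k => [|k IHk] kN; first by rewrite !mulr0n addr0.
  have kp_ge0 : 0 <= p *+ k by rewrite mulrn_wge0// ltW.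
  have xkM t : 0 <= t <= p -> `|x (t + p *+ k)| <= M.
    move=> /andP[t_ge0 t_le]; apply: xM; rewrite addr_ge0//=.
    by rewrite (le_trans (lerD t_le (lexx _)))// -mulrS ler_wpMn2l// ltW.
  have := d_incr _
    (solves_shift (periodicn A_per k) (periodicn g_per k) x_sol) xkM.
  have := IHk (ltnW kN).
  rewrite add0r -mulrS zp (mulrBr s (dotv _ _)) (mulrS d).
  lra.
have N_ge0 : 0 <= p *+ N by rewrite mulrn_wge0// ltW.
have := grow N (leqnn _).
have := pairing_le _ (xM 0 _); rewrite lexx N_ge0 => /(_ isT).
have := pairing_le _ (xM (p *+ N) _); rewrite lexx N_ge0 => /(_ isT).
rewrite !ler_norml => /andP[_ VN] /andP[V0 _].
have : B + B < d *+ N.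
  rewrite -mulr_natr -ltr_pdivrMl// mulrC.
  by rewrite (le_lt_trans (ler_norm _))// archi_boundP.
lra.
Qed.

Lemma unbounded_of_gap x : 0 <= s * solvability_gap gamma ->
  solves A f g x -> unbounded_pinfty x /\ unbounded_ninfty x.
Proof.
move=> gap_ge0 x_sol; split.
- move=> x_bnd.
  have PF : ProperFilter (globally `[(0 : R), +oo[).
    by apply: (@globally_properfilter _ _ 0); rewrite /= in_itv/= lexx.
  have [M xM] := (ex_bound x).1 x_bnd.
  have [N /(_ _ x_sol)] := uniform_escape M gap_ge0; apply=> t /andP[t_ge0 _].
  by apply: xM; rewrite /= in_itv/= t_ge0.
- move=> x_bnd.
  have PF : ProperFilter (globally `]-oo, (0 : R)]).
    by apply: (@globally_properfilter _ _ 0); rewrite /= in_itv/= lexx.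
  have [M xM] := (ex_bound x).1 x_bnd.
  have [N escape] := uniform_escape M gap_ge0.
  (* The translate by T = N p sees the window [-T, 0] as [0, T]. *)
  pose T := p *+ N.
  have perN (V : zmodType) (h : R -> V) : periodic h p -> periodic h (- T).
    by move=> h_per u; rewrite -(periodicn h_per N (u - T)) subrK.
  apply: (escape _ (solves_shift (perN _ _ A_per) (perN _ _ g_per) x_sol)).
  by move=> t /andP[_ t_le]; apply: xM; rewrite /= in_itv/= subr_le0.
Qed.

End Balance.

Theorem theorem4p1 (R : realType) (n : nat) (p : R)
    (A : R -> 'M[R]_n) (g : R -> 'cV[R]_n) (f : 'cV[R]_n -> 'cV[R]_n)
    (z : R -> 'cV[R]_n) (alpha beta : 'I_n -> R)
    (p_gt0 : 0 < p)
    (A_cont : forall i j, continuous (fun t : R => A t i j))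
    (A_per : periodic A p)
    (g_cont : forall i, continuous (fun t : R => g t i 0))
    (g_per : periodic g p)
    (f_cont : continuous f)
    (resonance : at_resonance p A)
    (z_sol : solves_adjoint A z)
    (z_per : periodic z p)
    (z_gt0 : forall t i, 0 < z t i 0)
    (f_bound : forall (x : 'cV[R]_n) (i : 'I_n),
       alpha i < f x i 0 < beta i) :
  ((exists x : R -> 'cV[R]_n, solves A f g x /\ periodic x p) ->
     solvability_condition p alpha beta g z) /\
  (~ solvability_condition p alpha beta g z ->
     forall x : R -> 'cV[R]_n, solves A f g x ->
       unbounded_pinfty x /\ unbounded_ninfty x).
Proof.
(* The dimension is positive: in dimension 0 every solution is zero, so the
   system would not be at resonance. *)
have [i0 _] : exists i0 : 'I_n, True.
  have [[y [_ _ [t /eqP yt]]] _] := resonance.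
  apply: contrapT => noi; apply: yt; apply/matrixP => i; case: noi; by exists i.
have alpha_side y i : 0 < -1 * (alpha i - f y i 0).
  by rewrite mulN1r opprB subr_gt0; have /andP[] := f_bound y i.
have beta_side y i : 0 < 1 * (beta i - f y i 0).
  by rewrite mul1r subr_gt0; have /andP[] := f_bound y i.
split=> [[x [x_sol x_per]]|].
  have closed : dotv (x p) (z p) - dotv (x 0) (z 0) = 0.
    by rewrite -[p]add0r x_per z_per subrr.
  have := gap_lt_increment p_gt0 g_cont z_sol i0 z_gt0 alpha_side x_sol.
  have := gap_lt_increment p_gt0 g_cont z_sol i0 z_gt0 beta_side x_sol.
  rewrite closed !mulr0 mul1r mulN1r oppr_lt0 subr_lt0 subr_gt0.
  by rewrite /solvability_condition => -> ->.
move=> /negP; rewrite negb_and -!leNgt => /orP[lo|hi] x x_sol.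
- apply: (unbounded_of_gap p_gt0 g_cont z_sol i0 f_cont A_per g_per z_per z_gt0
    alpha_side _ x_sol).
  by rewrite mulN1r oppr_ge0 subr_le0.
- apply: (unbounded_of_gap p_gt0 g_cont z_sol i0 f_cont A_per g_per z_per z_gt0
    beta_side _ x_sol).
  by rewrite mul1r subr_ge0.
Qed.
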